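(* For all integers $n,k\ge 0$, the map $\phi'$ defined below restricts to a bijection from the set of bilateral Dyck paths of semilength $n$ with $k$ up-steps at odd height onto the set of bilateral Dyck paths of semilength $n$ with $k$ peaks. Definition of $\phi'$: (a) if $W$ is a Dyck word, $\phi'(W)=\phi(W)$; (b) if $W$ is a negative Dyck word, $\phi'(W)=\alpha(\phi(\beta(\alpha(W))))$; (c) if the path of $W$ has $l>0$ crossings, $W$ decomposes uniquely as $W=W_1W_2\cdots W_{l+1}$ where the $W_i$ are alternately nonempty Dyck words and negative Dyck words, and $\phi'(W)=\phi'(W_1)\phi'(W_2)\cdots\phi'(W_{l+1})$. Here: $\alpha$ replaces every $U$ by $D$ and every $D$ by $U$ (reflection in the $x$-axis). $\beta$ is defined on Dyck words: a nonempty Dyck word decomposes uniquely as $UW_1DW_2$ with $W_1,W_2$ Dyck words, and $\beta(UW_1DW_2)=UW_2DW_1$. $\phi$ is defined on Dyck words by $\phi(\epsilon)=\epsilon$ and, for a nonempty Dyck word $W$ whose path has $s\ge0$ down-steps at height $2$ before its first contact, with unique decomposition $W=U\big(\prod_{i=1}^{s}UW_iD\big)DW_{s+1}$ ($W_i$ Dyck words), $\phi(W)=\big(\prod_{i=1}^{s}U\,\phi(W_i)\big)\,UD\,D^{s}\,\phi(W_{s+1})$.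
   Context: Paths have steps $(1,1)$ (up-step, letter $U$) and $(1,-1)$ (down-step, letter $D$), start at $(0,0)$; paths and words in $\{U,D\}$ are identified, $\epsilon$ is the empty word, products denote concatenation and $D^s$ is $s$ copies of $D$. A bilateral Dyck path is such a path ending on the line $y=0$ (no other restriction). A Dyck path is a bilateral Dyck path with no vertex of negative $y$-coordinate; a negative Dyck path is a bilateral Dyck path of nonzero length with no vertex of positive $y$-coordinate. The semilength is half the number of steps. An up-step is at height $j$ if it goes from $(i-1,j-1)$ to $(i,j)$; a down-step is at height $j$ if it goes from $(i,j)$ to $(i+1,j-1)$; it is at odd height if $j$ is odd. A peak is an up-step immediately followed by a down-step. A contact is a down-step at height $1$ or an up-step at height $0$. A crossing is a down-step at height $1$ immediately followed by a down-step at height $0$, or an up-step at height $0$ immediately followed by an up-step at height $1$. *)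

(* Defs.v *)
(* Words in {U,D} are encoded as seq bool: U = true, D = false. *)
From mathcomp Require Import all_boot all_order all_algebra.
Set Implicit Arguments. Unset Strict Implicit. Unset Printing Implicit Defensive.
Import Order.TTheory GRing.Theory Num.Theory.

Local Open Scope ring_scope.

Definition step (b : bool) : int := if b then 1 else -1.

Definition height (w : seq bool) : int := \sum_(b <- w) step b.

Definition bilateral (w : seq bool) : bool := height w == 0.

Definition dyck (w : seq bool) : bool :=
  bilateral w && [forall i : 'I_(size w).+1, 0 <= height (take i w)].

Definition neg_dyck (w : seq bool) : bool :=
  [&& size w != 0%N, bilateral w & [forall i : 'I_(size w).+1, height (take i w) <= 0]].

(* number of up-steps at odd height (an up-step from (i-1,j-1) to (i,j) is at height j) *)
Fixpoint oddups_from (h : int) (w : seq bool) : nat :=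
  match w with
  | [::] => 0%N
  | b :: w' => ((b && odd (absz (h + step b)%R)) + oddups_from (h + step b) w')%N
  end.
Definition oddups (w : seq bool) : nat := oddups_from 0 w.

Fixpoint peaks (w : seq bool) : nat :=
  match w with
  | b :: ((c :: _) as w') => ((b && ~~ c) + peaks w')%N
  | _ => 0%N
  end.

Definition alpha (w : seq bool) : seq bool := map negb w.

Fixpoint split_prime_from (h : int) (acc w : seq bool) : seq bool * seq bool :=
  match w with
  | [::] => (rev acc, [::])
  | b :: w' =>
      if h + step b == 0 then (rev (b :: acc), w')
      else split_prime_from (h + step b) (b :: acc) w'
  end.
Definition split_prime (w : seq bool) := split_prime_from 0 [::] w.

Definition strip (w : seq bool) : seq bool := take (size w - 2) (drop 1 w).

Fixpoint primes_f (f : nat) (w : seq bool) : seq (seq bool) :=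
  match f with
  | 0%N => [::]
  | f'.+1 => match w with
             | [::] => [::]
             | _ => (split_prime w).1 :: primes_f f' (split_prime w).2
             end
  end.
Definition primes (w : seq bool) := primes_f (size w) w.

Definition beta (w : seq bool) : seq bool :=
  match w with
  | [::] => [::]
  | _ => true :: (split_prime w).2 ++ false :: strip (split_prime w).1
  end.

(* phi on Dyck words:
   W = U (prod_{i=1}^s U W_i D) D W_{s+1}  |->
   (prod_{i=1}^s U phi(W_i)) U D D^s phi(W_{s+1}).
   The U W_i D are the prime factors of the interior of the first prime factor. *)
Fixpoint phi_f (f : nat) (w : seq bool) : seq bool :=
  match f with
  | 0%N => [::]
  | f'.+1 =>
      match w with
      | [::] => [::]
      | _ =>
          let p := (split_prime w).1 in
          let r := (split_prime w).2 in
          let fs := primes (strip p) in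
          flatten [seq true :: phi_f f' (strip q) | q <- fs]
            ++ [:: true; false] ++ nseq (size fs) false ++ phi_f f' r
      end
  end.
Definition phi (w : seq bool) : seq bool := phi_f (size w) w.

(* group consecutive prime pieces lying on the same side of the x-axis:
   this yields the decomposition W = W_1 ... W_{l+1} at the l crossings *)
Fixpoint group_side (ps : seq (seq bool)) : seq (seq bool) :=
  match ps with
  | [::] => [::]
  | p :: ps' =>
      match group_side ps' with
      | g :: gs => if head true p == head true g then (p ++ g) :: gs
                   else p :: g :: gs
      | [::] => [:: p]
      end
  end.
Definition crossing_blocks (w : seq bool) := group_side (primes w).

Definition phi' (w : seq bool) : seq bool :=
  flatten [seq (if head true g then phi g else alpha (phi (beta (alpha g))))
          | g <- crossing_blocks w].

(* Main.v *)
(** A Dyck word is coded by a binary tree ([Node a b] for [U a D b]), and a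
    bilateral word by a list of nonempty trees on alternating sides of the axis,
    one per crossing block.  On trees [phi] becomes a recursion intertwined with
    an auxiliary map, from which injectivity and the transport of statistics are
    read off: a tree with [o] up-steps at odd height is sent to one with [o]
    peaks.  On a negative block with [e] up-steps at odd height, the reflected
    Dyck word has [e] up-steps at even height; [beta] turns it into one with
    [e + 1] up-steps at odd height, and reflecting the image of that one turns
    its [e + 1] peaks into [e] peaks.  Finally, an injection of the finite set of
    bilateral words of given length is onto. *)
Require Import Defs.
From mathcomp Require Import all_boot all_order all_algebra.
From mathcomp Require Import zify.
Set Implicit Arguments. Unset Strict Implicit. Unset Printing Implicit Defensive.
Import GRing.Theory.

Lemma size_preserving_inj_onto (T : finType) (P : pred (seq T)) (f : seq T -> seq T) :
  {homo f : w / P w} -> {in P, forall w, size (f w) = size w} ->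
  {in P &, injective f} ->
  forall v, P v -> exists2 w, P w & f w = v.
Proof.
move=> Pf size_f inj_f v Pv; pose S := {w : (size v).-tuple T | P w}.
have size_fS (u : S) : size (f (val (val u))) == size v.
  by rewrite size_f ?size_tuple // unfold_in; case: u.
pose F (u : S) : S := Sub (Tuple (size_fS u)) (Pf _ (valP u)).
have inj_F : injective F.
  move=> u u' /(congr1 (fun u => tval (val u))) /= /inj_f eq_uu'.
  by do 2!apply: val_inj; apply: eq_uu'; rewrite unfold_in (valP u, valP u').
have [G _ FG] := injF_bij inj_F.
pose v' : S := Sub (in_tuple v) Pv.
exists (val (val (G v'))); first exact: valP (G v').
by have /(congr1 (fun u => tval (val u))) := FG v'.
Qed.

(** * Statistics of words *)

Lemma height_nil : height [::] = 0%R.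
Proof. by rewrite /height big_nil. Qed.

Lemma height_cons b w : height (b :: w) = (step b + height w)%R.
Proof. by rewrite /height big_cons. Qed.

Lemma height_cat u v : height (u ++ v) = (height u + height v)%R.
Proof. by rewrite /height big_cat. Qed.

Lemma stepN b : step (~~ b) = (- step b)%R.
Proof. by case: b. Qed.

Lemma oddups_from_cat h u v :
  oddups_from h (u ++ v) = oddups_from h u + oddups_from (h + height u)%R v.
Proof.
elim: u h => [|b u IHu] h /=; first by rewrite height_nil addr0.
by rewrite IHu height_cons addrA addnA.
Qed.

Lemma odd_absz_step h b : odd (absz (h + step b)%R) = ~~ odd (absz h).
Proof. by case: b => /=; lia. Qed.

Lemma peaks_cons b w : peaks (b :: w) = (b && ~~ head true w) + peaks w.
Proof. by case: w => //=; rewrite andbF. Qed.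

Lemma peaks_cat u v :
  peaks (u ++ v) = peaks u + (last false u && ~~ head true v) + peaks v.
Proof.
elim: u => [|b u IHu] //; rewrite cat_cons !peaks_cons IHu.
by case: u {IHu} => [|c u] /=; rewrite ?andbF ?addn0 ?addnA.
Qed.

(* Peaks and valleys alternate along a word. *)
Lemma peaks_alpha b w : peaks w + last b w = peaks (alpha w) + head b w.
Proof.
elim: w b => // c w IHw b; have := IHw c.
rewrite [alpha (c :: w)]/= -/(alpha w) !peaks_cons.
by case: w {IHw} => [|d w]; case: c => /=; lia.
Qed.

(** * Binary trees and their words *)

Inductive dyck_tree := Leaf | Node of dyck_tree & dyck_tree.

Fixpoint tree_word (s : bool) (t : dyck_tree) : seq bool :=
  if t is Node a b then s :: tree_word s a ++ ~~ s :: tree_word s b else [::].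

Definition prime_word (s : bool) (a : dyck_tree) : seq bool :=
  s :: tree_word s a ++ [:: ~~ s].

Fixpoint branches (t : dyck_tree) : seq dyck_tree :=
  if t is Node a b then a :: branches b else [::].

Fixpoint tree_rcons (t c : dyck_tree) : dyck_tree :=
  if t is Node a b then Node a (tree_rcons b c) else Node c Leaf.

Lemma tree_word_Node s a b : tree_word s (Node a b) = prime_word s a ++ tree_word s b.
Proof. by rewrite /prime_word /= -catA. Qed.

Lemma size_tree_word_Node s a b :
  size (tree_word s (Node a b)) = (size (tree_word s a) + size (tree_word s b)).+2.
Proof. by rewrite /= size_cat /= addnS. Qed.

Lemma tree_word_branches s t :
  tree_word s t = flatten (map (prime_word s) (branches t)).
Proof. by elim: t => // a _ b IHb; rewrite tree_word_Node IHb. Qed.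

Lemma tree_word_rcons s t c :
  tree_word s (tree_rcons t c) = tree_word s t ++ prime_word s c.
Proof. by elim: t => //= a _ b ->; rewrite -catA. Qed.

Lemma tree_rcons_inj t t' c c' : tree_rcons t c = tree_rcons t' c' -> t = t' /\ c = c'.
Proof.
elim: t t' => [|a _ b IHb] [|a' b'] //=; first by case.
- by case: b' => [|? ?] [].
- by case: b {IHb} => [|? ?] [].
by case=> -> /IHb[-> ->].
Qed.

Lemma alpha_tree_word s t : alpha (tree_word s t) = tree_word (~~ s) t.
Proof.
by elim: t => //= a IHa b IHb; rewrite /alpha map_cat /= -!/(alpha _) IHa IHb.
Qed.

Lemma height_tree_word s t : height (tree_word s t) = 0%R.
Proof.
elim: t => [|a IHa b IHb] /=; first exact: height_nil.
by rewrite height_cons height_cat height_cons IHa IHb stepN add0r addr0 subrr.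
Qed.

Lemma last_tree_word x s a b : last x (tree_word s (Node a b)) = ~~ s.
Proof.
elim: b a x => [|c _ d IHd] a x; rewrite tree_word_Node last_cat; last exact: IHd.
by rewrite /= last_cat.
Qed.

(** * Prime factors *)

(* A prime word on side [s] stays at heights [step s * m.+1] until its last step. *)
Lemma split_prime_from_tree_word s t m acc w :
  split_prime_from (step s * m.+1%:Z)%R acc (tree_word s t ++ w) =
  split_prime_from (step s * m.+1%:Z)%R (rev (tree_word s t) ++ acc) w.
Proof.
have away n : (step s * n.+1%:Z + step s = step s * n.+2%:Z)%R by case: s => /=; lia.
have back n : (step s * n.+2%:Z + step (~~ s) = step s * n.+1%:Z)%R.
  by case: s {away} => /=; lia.
have off_axis n : (step s * n.+1%:Z == 0)%R = false by case: s {away back} => /=; lia.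
elim: t m acc w => //= a IHa b IHb m acc w.
rewrite away off_axis -catA IHa /= back off_axis IHb.
by rewrite rev_cons rev_cat rev_cons cat_rcons -!cats1 -!catA.
Qed.

Lemma split_prime_cat s a w : split_prime (prime_word s a ++ w) = (prime_word s a, w).
Proof.
rewrite /split_prime /prime_word /= add0r ifF; last by case: s.
rewrite -[step s]mulr1 -catA split_prime_from_tree_word /=.
rewrite mulr1 stepN subrr eqxx.
by rewrite rev_cons rev_cat revK /= -cats1.
Qed.

Lemma split_prime_Node s a b :
  split_prime (tree_word s (Node a b)) = (prime_word s a, tree_word s b).
Proof. by rewrite tree_word_Node split_prime_cat. Qed.

Lemma strip_prime s a : strip (prime_word s a) = tree_word s a.
Proof. by rewrite /strip /prime_word /= size_cat addn1 subn2 drop0 take_size_cat. Qed.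

Lemma tree_word_inj s : injective (tree_word s).
Proof.
elim=> [|a IHa b IHb] [|c d] //.
move/(congr1 (fun w => (strip (split_prime w).1, (split_prime w).2))).
by rewrite !split_prime_Node !strip_prime => -[/IHa-> /IHb->].
Qed.

Lemma size_split_prime_from h acc w : size (split_prime_from h acc w).2 <= (size w).-1.
Proof.
elim: w h acc => //= b w IHw h acc; case: ifP => //= _.
exact: leq_trans (IHw _ _) (leq_pred _).
Qed.

Lemma primes_f_fuel f w : size w <= f -> primes_f f w = Defs.primes w.
Proof.
rewrite /Defs.primes; move: {2 4}(size w) (leqnn (size w)) => g.
elim: f g w => [|f IHf] [|g] [|b w] // le_w_g le_w_f.
have le_rest := size_split_prime_from 0 [::] (b :: w).
by congr (_ :: _); apply: IHf; apply: leq_trans le_rest _.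
Qed.

Lemma primes_prime_cat s a w :
  Defs.primes (prime_word s a ++ w) = prime_word s a :: Defs.primes w.
Proof.
rewrite {1}/Defs.primes [LHS]/= (split_prime_cat s a w) primes_f_fuel //.
by rewrite size_cat leq_addl.
Qed.

Lemma primes_tree_word_cat s t w :
  Defs.primes (tree_word s t ++ w) = map (prime_word s) (branches t) ++ Defs.primes w.
Proof.
by elim: t => // a _ b IHb; rewrite tree_word_Node -catA primes_prime_cat IHb.
Qed.

Lemma primes_tree_word s t :
  Defs.primes (tree_word s t) = map (prime_word s) (branches t).
Proof. by rewrite -[tree_word s t]cats0 primes_tree_word_cat cats0. Qed.

(** * The map [phi] on trees *)

(* [tree_phi true] is [phi], and [U (tree_phi false a) D] is the first prime
   factor of [phi (U a D b)]. *)
Fixpoint tree_phi (p : bool) (t : dyck_tree) : dyck_tree :=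
  if t is Node a b then
    if p then Node (tree_phi false a) (tree_phi true b)
    else tree_rcons (tree_phi true a) (tree_phi false b)
  else Leaf.

Lemma prime_word_tree_phi a :
  prime_word true (tree_phi false a) =
  flatten [seq true :: tree_word true (tree_phi true c) | c <- branches a] ++
    [:: true; false] ++ nseq (size (branches a)) false.
Proof.
elim: a => // c _ d IHd.
rewrite {1}/prime_word /= tree_word_rcons IHd -!catA.
by rewrite -[[:: false]]/(nseq 1 false) -nseqD addn1.
Qed.

Lemma phi_f_Node f a b :
  phi_f f.+1 (tree_word true (Node a b)) =
  flatten [seq true :: phi_f f (tree_word true c) | c <- branches a] ++
    [:: true; false] ++ nseq (size (branches a)) false ++ phi_f f (tree_word true b).
Proof.
rewrite [LHS]/= (split_prime_Node true a b) strip_prime primes_tree_word size_map.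
by rewrite -map_comp; congr (flatten _ ++ _); apply: eq_map => c /=; rewrite strip_prime.
Qed.

Lemma phi_f_tree_word f t :
  size (tree_word true t) <= f ->
  phi_f f (tree_word true t) = tree_word true (tree_phi true t).
Proof.
elim: f t => [|f IHf] [|a b] //; rewrite size_tree_word_Node => lt_ab_f.
have phi_branches : [seq true :: phi_f f (tree_word true c) | c <- branches a] =
                    [seq true :: tree_word true (tree_phi true c) | c <- branches a].
  have: size (tree_word true a) <= f by lia.
  elim: a {lt_ab_f} => // c _ d IHd; rewrite size_tree_word_Node => lt_cd_f.
  by rewrite /= IHf ?IHd //; lia.
rewrite phi_f_Node phi_branches IHf; last by lia.
by rewrite /= [RHS]tree_word_Node prime_word_tree_phi -!catA.
Qed.

Lemma phi_tree_word t : phi (tree_word true t) = tree_word true (tree_phi true t).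
Proof. exact: phi_f_tree_word. Qed.

Lemma beta_tree_word a b :
  beta (tree_word true (Node a b)) = tree_word true (Node b a).
Proof. by rewrite [LHS]/= (split_prime_Node true a b) strip_prime. Qed.

Lemma tree_phi_inj p : injective (tree_phi p).
Proof.
move=> t; elim: t p => [|a IHa b IHb] [] [|c d] //=.
- by case: (tree_phi true c).
- by case=> /IHa-> /IHb->.
- by case: (tree_phi true a).
- by case/tree_rcons_inj=> /IHa-> /IHb->.
Qed.

Lemma size_tree_phi s p t : size (tree_word s (tree_phi p t)) = size (tree_word s t).
Proof.
elim: t p => // a IHa b IHb [] /=; first by rewrite !size_cat /= IHa IHb.
by rewrite tree_word_rcons !size_cat /= size_cat /= IHa IHb; lia.
Qed.

(* Counts the up-steps of [tree_word true t] at odd height if [p], at even height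
   otherwise. *)
Fixpoint parity_ups (p : bool) (t : dyck_tree) : nat :=
  if t is Node a b then p + parity_ups (~~ p) a + parity_ups p b else 0.

Lemma oddups_from_tree_word h s t :
  oddups_from h (tree_word s t) = parity_ups (odd (absz h) (+) s) t.
Proof.
elim: t h => //= a IHa b IHb h.
rewrite oddups_from_cat /= height_tree_word addr0 stepN addrK IHa IHb odd_absz_step.
by rewrite addNb; case: s {IHa IHb}; case: (odd _) => /=; lia.
Qed.

Lemma peaks_prime_rcons t c :
  peaks (prime_word true (tree_rcons t c)) =
  peaks (tree_word true t) + peaks (prime_word true c).
Proof.
rewrite /prime_word tree_word_rcons peaks_cons -catA.
have -> : head true (tree_word true t ++ prime_word true c ++ [:: false]) by case: t.
rewrite peaks_cat andbF [peaks (_ ++ [:: false])]peaks_cat.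
by rewrite /prime_word /= last_cat /= andbF !addn0.
Qed.

Lemma peaks_tree_phi p t :
  peaks (if p then tree_word true (tree_phi p t) else prime_word true (tree_phi p t)) =
  parity_ups p t + ~~ p.
Proof.
elim: t p => [|a IHa b IHb] []; rewrite // [tree_phi _ _]/=.
- rewrite tree_word_Node peaks_cat (IHa false) (IHb true).
  by rewrite /prime_word /= last_cat /=; lia.
- by rewrite peaks_prime_rcons (IHa true) (IHb false) /=; lia.
Qed.

(** * Crossing blocks *)

Record block := Block { side : bool; first_branch : dyck_tree; rest : dyck_tree }.

Definition block_tree (g : block) : dyck_tree := Node (first_branch g) (rest g).

Definition block_word (g : block) : seq bool := tree_word (side g) (block_tree g).

Definition blocks_word (gs : seq block) : seq bool := flatten (map block_word gs).

Definition alternating : pred (seq block) := sorted [rel g g' | side g != side g'].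

Lemma block_word_inj : injective block_word.
Proof.
move=> [s a b] [s' a' b'] eq_words.
have eq_s : s = s' := congr1 (head true) eq_words.
by move: eq_words; rewrite /block_word eq_s => /tree_word_inj[-> ->].
Qed.

Lemma blocks_word_cons g gs : blocks_word (g :: gs) = block_word g ++ blocks_word gs.
Proof. by []. Qed.

Lemma height_blocks_word gs : height (blocks_word gs) = 0%R.
Proof.
elim: gs => [|g gs IHgs]; first exact: height_nil.
by rewrite blocks_word_cons height_cat IHgs height_tree_word.
Qed.

Lemma group_side_cat s ps qs :
  ps != [::] -> all (fun p => ohead p == Some s) ps ->
  ohead (map (head true) (group_side qs)) != Some s ->
  group_side (ps ++ qs) = flatten ps :: group_side qs.
Proof.
elim: ps => // -[//|x p] ps IHps _ /andP[/eqP[->] starts_ps] next_side /=.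
case: ps IHps starts_ps => [_ _|p' ps IHps starts_ps].
  rewrite cats0 /=; case: (group_side qs) next_side => //= g gs.
  by rewrite (inj_eq Some_inj) eq_sym => /negbTE->.
rewrite IHps //= [head _ _](_ : _ = s) ?eqxx //.
by case: p' starts_ps {IHps} => //= y p' /andP[/eqP[->]].
Qed.

Lemma crossing_blocks_word gs :
  alternating gs -> crossing_blocks (blocks_word gs) = map block_word gs.
Proof.
rewrite /crossing_blocks; elim: gs => // -[s a b] gs IHgs alt.
have {}IHgs := IHgs (path_sorted alt).
rewrite blocks_word_cons /block_word primes_tree_word_cat.
rewrite (@group_side_cat s) -?tree_word_branches ?IHgs //.
  by elim: (branches _) => //= c cs ->; rewrite eqxx.
by case: gs alt {IHgs} => //= -[s' a' b'] gs /andP[/= ns _]; rewrite eq_sym.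
Qed.

Lemma blocks_word_inj : {in alternating &, injective blocks_word}.
Proof.
move=> gs gs' alt alt' /(congr1 crossing_blocks).
by rewrite !crossing_blocks_word // => /(inj_map block_word_inj).
Qed.

Definition add_prime (s : bool) (a : dyck_tree) (gs : seq block) : seq block :=
  match gs with
  | Block s' b c :: gs' =>
      if s == s' then Block s a (Node b c) :: gs' else Block s a Leaf :: gs
  | [::] => [:: Block s a Leaf]
  end.

Lemma blocks_word_add_prime s a gs :
  blocks_word (add_prime s a gs) = prime_word s a ++ blocks_word gs.
Proof.
case: gs => [|[s' b c] gs] //; rewrite /add_prime; case: eqP => [<-|_] //.
by rewrite !blocks_word_cons catA -tree_word_Node.
Qed.

Lemma alternating_add_prime s a gs : alternating gs -> alternating (add_prime s a gs).
Proof.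
case: gs => [|[s' b c] gs] //=; case: eqVneq => [->|ns] /=; last by rewrite ns.
by case: gs.
Qed.

(* A word read from right to left: before its closed part stand the words of the
   trees [ts], each followed by a step [~~ s] that still awaits a partner [s]. *)
Definition pending_word (s : bool) (ts : seq dyck_tree) : seq bool :=
  flatten [seq rcons (tree_word s t) (~~ s) | t <- ts].

Lemma height_pending_word s ts :
  height (pending_word s ts) = (step (~~ s) * (size ts)%:Z)%R.
Proof.
rewrite /pending_word; elim: ts => [|t ts IHts] /=; first by rewrite height_nil mulr0.
rewrite -cats1 !height_cat height_tree_word IHts height_cons height_nil.
by rewrite add0r addr0 intS mulrDr mulr1.
Qed.

Lemma pending_blocks_exist w :
  exists s ts gs, alternating gs /\ w = pending_word s ts ++ blocks_word gs.
Proof.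
elim: w => [|b w [s [ts [gs [alt ->]]]]]; first by exists true, [::], [::].
case: (eqVneq b s) => [->|nbs]; last first.
  exists s, (Leaf :: ts), gs; split=> //=; congr (_ :: _).
  by case: b s nbs {ts} => [] [].
case: ts => [|t [|u ts]].
- by exists (~~ s), [:: Leaf], gs; split=> //=; rewrite /pending_word /= negbK.
- exists s, [::], (add_prime s t gs); split; first exact: alternating_add_prime.
  by rewrite blocks_word_add_prime /pending_word /prime_word /= cats0 -cats1.
exists s, (Node t u :: ts), gs; split=> //.
by rewrite /pending_word /= -!cats1 -!catA.
Qed.

Lemma bilateral_blocks w :
  bilateral w -> exists2 gs, alternating gs & w = blocks_word gs.
Proof.
have [s [ts [gs [alt ->]]]] := pending_blocks_exist w.
rewrite /bilateral height_cat height_blocks_word height_pending_word addr0 => no_pending.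
exists gs => //; suff -> : ts = [::] by [].
by case: ts no_pending => // t ts; case: s.
Qed.

(** * The map [phi'] on blocks *)

(* The swap on the negative side is [beta]. *)
Definition phi_block (g : block) : block :=
  let: Block s a b := g in
  if s then Block true (tree_phi false a) (tree_phi true b)
  else Block false (tree_phi false b) (tree_phi true a).

Lemma side_phi_block g : side (phi_block g) = side g.
Proof. by case: g => -[]. Qed.

Lemma alternating_phi_blocks gs : alternating gs -> alternating (map phi_block gs).
Proof.
rewrite /alternating sorted_map; apply: sub_sorted => g g' /=.
by rewrite !side_phi_block.
Qed.

Lemma phi_block_inj : injective phi_block.
Proof. by move=> [[] a b] [[] a' b'] //= [/tree_phi_inj-> /tree_phi_inj->]. Qed.

Lemma size_phi_block g : size (block_word (phi_block g)) = size (block_word g).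
Proof.
by case: g => -[] a b; rewrite /block_word /= !size_cat /= !size_tree_phi //; lia.
Qed.

Lemma phi'_blocks_word gs :
  alternating gs -> phi' (blocks_word gs) = blocks_word (map phi_block gs).
Proof.
move=> alt; rewrite /phi' crossing_blocks_word // /blocks_word -!map_comp.
congr flatten; apply: eq_map => -[[] a b]; rewrite /comp /block_word [head _ _]/=.
  exact: phi_tree_word.
by rewrite alpha_tree_word beta_tree_word phi_tree_word alpha_tree_word.
Qed.

Lemma oddups_blocks_word gs :
  oddups (blocks_word gs) = \sum_(g <- gs) parity_ups (side g) (block_tree g).
Proof.
rewrite /oddups; elim: gs => [|g gs IHgs]; first by rewrite big_nil.
rewrite blocks_word_cons oddups_from_cat height_tree_word addr0 IHgs big_cons.
by rewrite oddups_from_tree_word.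
Qed.

Lemma peaks_blocks_word gs :
  alternating gs -> peaks (blocks_word gs) = \sum_(g <- gs) peaks (block_word g).
Proof.
elim: gs => [|g gs IHgs] alt; first by rewrite big_nil.
rewrite big_cons blocks_word_cons peaks_cat last_tree_word (IHgs (path_sorted alt)).
have -> : ~~ side g && ~~ head true (blocks_word gs) = false; last by rewrite addn0.
case: gs alt {IHgs} => [|g' gs] /=; first by rewrite andbF.
by case/andP=> opposite _; case: (side g) (side g') opposite => [] [].
Qed.

Lemma peaks_phi_block g :
  peaks (block_word (phi_block g)) = parity_ups (side g) (block_tree g).
Proof.
case: g => -[] a b; first by rewrite (peaks_tree_phi true (Node a b)) addn0.
have := peaks_alpha true (block_word (phi_block (Block false a b))).
by rewrite last_tree_word alpha_tree_word (peaks_tree_phi true (Node b a)) /=; lia.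
Qed.

Lemma phi'_bilateral w : bilateral w -> bilateral (phi' w).
Proof.
case/bilateral_blocks=> gs alt ->.
by rewrite phi'_blocks_word // /bilateral height_blocks_word.
Qed.

Lemma size_phi' w : bilateral w -> size (phi' w) = size w.
Proof.
case/bilateral_blocks=> gs alt ->; rewrite phi'_blocks_word //.
elim: gs {alt} => // g gs IHgs.
by rewrite !blocks_word_cons !size_cat size_phi_block IHgs.
Qed.

Lemma peaks_phi' w : bilateral w -> peaks (phi' w) = oddups w.
Proof.
case/bilateral_blocks=> gs alt ->; rewrite phi'_blocks_word // oddups_blocks_word.
rewrite peaks_blocks_word ?alternating_phi_blocks // big_map.
by apply: eq_bigr => g _; apply: peaks_phi_block.
Qed.

Lemma phi'_inj : {in bilateral &, injective phi'}.
Proof.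
move=> _ _ /bilateral_blocks[gs alt ->] /bilateral_blocks[gs' alt' ->].
rewrite !phi'_blocks_word // => /blocks_word_inj eq_gs.
by rewrite (inj_map phi_block_inj (eq_gs _ _)) //; apply: alternating_phi_blocks.
Qed.

Lemma phi'_onto v : bilateral v -> exists2 w, bilateral w & phi' w = v.
Proof. exact: size_preserving_inj_onto phi'_bilateral size_phi' phi'_inj v. Qed.

Theorem theorem2 (n k : nat) :
  let A := fun w : seq bool => [&& bilateral w, size w == n.*2 & oddups w == k] in
  let B := fun w : seq bool => [&& bilateral w, size w == n.*2 & peaks w == k] in
  (forall w, A w -> B (phi' w)) /\
  (forall w1 w2, A w1 -> A w2 -> phi' w1 = phi' w2 -> w1 = w2) /\
  (forall v, B v -> exists2 w, A w & phi' w = v).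
Proof.
move=> A B; have AB w : bilateral w -> B (phi' w) = A w.
  by move=> bil_w; rewrite /A /B phi'_bilateral // bil_w size_phi' // peaks_phi'.
split=> [w Aw|]; first by rewrite AB //; case/andP: Aw.
split=> [w1 w2 /andP[bil_w1 _] /andP[bil_w2 _]|v Bv]; first exact: phi'_inj.
have [w bil_w phi'_w] : exists2 w, bilateral w & phi' w = v.
  by apply: phi'_onto; case/andP: Bv.
by exists w; rewrite // -AB // phi'_w.
Qed.
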